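(* Let $\lambda:\mathbb{Z}_+\to[0,\infty)$ with $\lambda(0)>0$. Assume $\lambda$ is nonincreasing and $\lambda(n)=0$ eventually for large $n$, and fix $\mu_1>0$. Then: - if $\lambda(0)\le\mu_1$, then $S(\lambda,\mu_1,\mu_2)$ is stable for all $\mu_2>0$; - if $\lambda(0)>\mu_1$, then $S(\lambda,\mu_1,\mu_2)$ becomes eventually unstable for large $\mu_2$, i.e. there is $M>0$ such that $S(\lambda,\mu_1,\mu_2)$ is not stable for all $\mu_2>M$.
   Context: $\mathbb{Z}_+=\{0,1,2,\dots\}$ and $e_1,e_2$ are the unit vectors of $\mathbb{Z}_+^2$. The system $S(\lambda,\mu_1,\mu_2)$ (for a nonnegative function $\lambda$ on $\mathbb{Z}_+$ and $\mu_1,\mu_2>0$) is the set of transition rates $q(x,y)$, $x\ne y$, $x,y\in\mathbb{Z}_+^2$, given by $q(x,x+e_1)=\lambda(x_2)$; $q(x,x-e_1+e_2)=\mu_1$ if $x_1\ge1$; $q(x,x-e_2)=\mu_2$ if $x_2\ge 1$; and $q(x,y)=0$ otherwise. Set $q(x)=\sum_{y\ne x}q(x,y)<\infty$ and $q(x,x)=-q(x)$. These rates define, by the minimal construction, a unique continuous-time Markov process $X=(X_1,X_2)$ on $\mathbb{Z}_+^2\cup\{\kappa\}$, where $\kappa$ is an extra state entered at the explosion time. The system is called stable if this Markov process is ergodic, that is, irreducible and positive recurrent (on $\mathbb{Z}_+^2$). *)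

(* Defs.v *)
From HB Require Import structures.
From mathcomp Require Import all_boot all_order all_algebra.
From mathcomp Require Import all_classical all_reals all_analysis.
(* [all_analysis] does not export the measurable structure of [\bar R]. *)
From mathcomp Require Import measurable_realfun.
Set Implicit Arguments.
Unset Strict Implicit.
Unset Printing Implicit Defensive.
Import Order.TTheory GRing.Theory Num.Theory.

Local Open Scope classical_set_scope.
Local Open Scope ring_scope.

(* q(x) = sum_(y != x) q(x,y).  Only the off-diagonal values of a rate function
   [q] are ever used.  The sum is assumed finite: [fine] would turn +oo
   into 0. *)
Definition exit_rate (R : realType) (E : countType) (q : E -> E -> R) (x : E)
  : R := fine (\esum_(y in [set y | y != x]) (q x y)%:E)%E.

(* Transition matrix of the embedded jump chain; a state with zero exit rate
   is absorbing. *)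
Definition jump_prob (R : realType) (E : countType) (q : E -> E -> R) (x y : E)
  : R :=
  if exit_rate q x == 0 then (y == x)%:R
  else if y == x then 0 else q x y / exit_rate q x.

(* The minimal construction: a jump chain [chain] and holding times [hold]
   which, under [prob x] (the law of the process started at [x]), have joint
   law determined by
     P_x (Y_0 = y_0, S_0 > t_0, ..., Y_n = y_n, S_n > t_n)
       = 1(y_0 = x) prod_(i < n) jump_prob (y_i, y_(i+1))
         prod_(i <= n) exp (- q(y_i) t_i),
   i.e. [chain] is the embedded Markov chain and, given it, the holding times
   are independent and exponential of rate q(y_i).  Holding times take values
   in ]0, +oo]; the value +oo accounts for absorbing states. *)
Record minimal_process (R : realType) (E : countType) (q : E -> E -> R)
    (d : measure_display) (Omega : measurableType d) := MinimalProcess {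
  prob : E -> probability Omega R ;
  chain : nat -> Omega -> E ;
  hold : nat -> Omega -> \bar R ;
  measurable_chain : forall n y, measurable (chain n @^-1` [set y]) ;
  measurable_hold : forall n, measurable_fun [set: Omega] (hold n) ;
  hold_gt0 : forall n w, (0 < hold n w)%E ;
  chain_hold_law : forall (x : E) (n : nat) (y : nat -> E) (t : nat -> R),
    (forall i, 0 <= t i) ->
    prob x [set w | forall i, (i <= n)%N ->
                      chain i w = y i /\ ((t i)%:E < hold i w)%E] =
    ((y 0%N == x)%:R * (\prod_(i < n) jump_prob q (y i) (y i.+1)) *
     \prod_(i < n.+1) expR (- (exit_rate q (y i) * t i)))%:E }.

Section Process.
Variables (R : realType) (E : countType) (q : E -> E -> R).
Variables (d : measure_display) (Omega : measurableType d).
Variable X : minimal_process q Omega.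

Definition jump_time (n : nat) (w : Omega) : \bar R :=
  (\sum_(i < n) hold X i w)%E.

(* X_t = Y_n for J_n <= t < J_(n+1); [None] is the extra state kappa, occupied
   from the explosion time sup_n J_n on. *)
Definition path (t : R) (w : Omega) : option E :=
  xget None [set s | exists2 n : nat,
    (jump_time n w <= t%:E < jump_time n.+1 w)%E & s = Some (chain X n w)].

(* T_x = inf {t >= J_1 | X_t = x}, equal to +oo if there is no such t. *)
Definition return_time (x : E) (w : Omega) : \bar R :=
  ereal_inf [set t%:E | t in
    [set t : R | (jump_time 1 w <= t%:E)%E /\ path t w = Some x]].

(* Absorbing states are positive recurrent, as usual, although their
   [return_time] is +oo. *)
Definition positive_recurrent : Prop :=
  forall x : E, exit_rate q x = 0 \/
    (\int[prob X x]_w return_time x w < +oo)%E.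

Definition irreducible : Prop :=
  forall x y : E, exists2 t : R, 0 <= t &
    (0 < prob X x [set w | path t w = Some y])%E.

Definition ergodic : Prop := irreducible /\ positive_recurrent.

End Process.

(* The transition rates of the system S(lambda, mu1, mu2). The three target
   states are pairwise distinct, so the order of the tests is irrelevant. *)
Definition tandem_rate (R : realType) (lambda : nat -> R) (mu1 mu2 : R)
    (x y : nat * nat) : R :=
  if y == (x.1.+1, x.2) then lambda x.2
  else if (1 <= x.1)%N && (y == (x.1.-1, x.2.+1)) then mu1
  else if (1 <= x.2)%N && (y == (x.1, x.2.-1)) then mu2
  else 0.

(* "The Markov process with these rates" is any of its realizations: they all
   have the same law, and ergodicity depends on the law only. *)
Definition stable (R : realType) (lambda : nat -> R) (mu1 mu2 : R)
    (d : measure_display) (Omega : measurableType d)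
    (X : minimal_process (tandem_rate lambda mu1 mu2) Omega) : Prop :=
  ergodic X.

(* Main.v *)
Require Import Defs.
From HB Require Import structures.
From mathcomp Require Import all_boot all_order all_algebra.
From mathcomp Require Import all_classical all_reals all_analysis.
From mathcomp Require Import measurable_realfun.
From mathcomp Require Import zify lra.
Set Implicit Arguments.
Unset Strict Implicit.
Unset Printing Implicit Defensive.
Import Order.TTheory GRing.Theory Num.Theory.
Local Open Scope ring_scope.

(** The first coordinate has drift [lambda x2 - mu1] while it is positive, and
    the second one then behaves like an M/M/1 queue with arrival rate [mu1] and
    service rate [mu2].  Both halves follow from one test function of the form
    [x1 + h x2], where [h] corrects for the fluctuations of the second queue.

    Stability.  Since [lambda <= mu1], the drift of [x1] is never positive for
    [x1 >= 1], and it is [- mu1] for large [x2].  A function [h] that decreases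
    very slightly where [lambda] may be positive, and has slope 1/2 where
    [lambda] vanishes, makes the drift of [x1 + h x2] at most [- eps] outside a
    finite part of the boundary [x1 = 0] ([negative_drift]).  This is Foster's
    criterion.

    Instability.  With [c = (lambda 0 - mu1) / mu1], the function [x1 - c x2] has
    nonnegative drift everywhere once [mu2 >= lambda 0 / c]
    ([positive_drift]), so it is a submartingale with bounded increments along
    the jump chain.  Started from the empty system and killed at the return
    there, where it vanishes, its mean never drops below a positive constant;
    but after [n] jumps it is at most of order [n], so the probability of having
    not yet returned is at least of order [1/n], which is not summable
    ([avoid_lower_bound]).

    Both arguments concern the probabilities [avoid n x] that the jump chain
    started at [x] does not visit [x] at steps [1, ..., n].  They are iterates of
    the taboo operator, the transition operator killed at [x].  As the exit rates
    lie between two positive constants, the mean return time of the process is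
    finite if and only if these probabilities are summable.  The comparison is
    made pointwise: counting the integers
    below each holding time bounds the return time above by a double series of
    indicators ([return_time_le]), and counting the holding times that exceed 1
    bounds it below ([return_time_ge]); the probability of each event counted is
    an iterate of the taboo operator ([avoids_held_law]).

    Irreducibility holds because [lambda 0 > 0]: every state leads to the empty
    system and back ([reaches_empty], [empty_reaches]). *)

(** * Chains killed at a state *)

Section Taboo.
Variables (R : realType) (E : eqType) (p : E -> E -> R) (nb : E -> seq E).
Hypothesis p_ge0 : forall y z, 0 <= p y z.
Hypothesis p_sum : forall y, \sum_(z <- nb y) p y z = 1.
Variable x : E.

Definition taboo (g : E -> R) (y : E) : R :=
  \sum_(z <- nb y | z != x) p y z * g z.

Definition avoid (n : nat) : E -> R := iter n taboo (fun=> 1).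

Lemma taboo_le g h : (forall y, g y <= h y) -> forall y, taboo g y <= taboo h y.
Proof. by move=> gh y; apply: ler_sum => z _; rewrite ler_wpM2l. Qed.

Lemma taboo_iter_le n g h : (forall y, g y <= h y) ->
  forall y, iter n taboo g y <= iter n taboo h y.
Proof. by move=> gh; elim: n => //= n; exact: taboo_le. Qed.

Lemma tabooZ c g y : taboo (fun z => c * g z) y = c * taboo g y.
Proof. by rewrite /taboo mulr_sumr; apply: eq_bigr => z _; rewrite mulrCA. Qed.

Lemma eq_taboo g h y : g =1 h -> taboo g y = taboo h y.
Proof. by move=> gh; apply: eq_bigr => z _; rewrite gh. Qed.

Lemma taboo_iterZ n c g y :
  iter n taboo (fun z => c * g z) y = c * iter n taboo g y.
Proof.
by elim: n y => //= n IH y; rewrite -tabooZ; exact: eq_taboo.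
Qed.

Lemma tabooD g h y : taboo (fun z => g z + h z) y = taboo g y + taboo h y.
Proof. by rewrite /taboo -big_split; apply: eq_bigr => z _; rewrite mulrDr. Qed.

Lemma taboo_sum n (g : nat -> E -> R) y :
  taboo (fun z => \sum_(k < n) g k z) y = \sum_(k < n) taboo (g k) y.
Proof.
rewrite /taboo exchange_big /=.
by apply: eq_bigr => z _; rewrite mulr_sumr.
Qed.

(** The taboo operator is dominated by the transition operator on nonnegative
    functions, so that a drift condition on the chain passes to the killed chain. *)
Lemma taboo_le_step g y : (forall z, 0 <= g z) ->
  taboo g y <= \sum_(z <- nb y) p y z * g z.
Proof.
move=> g0; rewrite [leRHS](bigID (fun z => z != x)) /= lerDl.
by apply: sumr_ge0 => z _; rewrite mulr_ge0.
Qed.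

Lemma avoid_ge0 n y : 0 <= avoid n y.
Proof.
elim: n y => [|n IH] y; first exact: ler01.
by apply: sumr_ge0 => z _; rewrite mulr_ge0 ?IH.
Qed.

Lemma avoidS n y : avoid n.+1 y <= avoid n y.
Proof.
elim: n y => [|n IH] y; last exact: taboo_le.
rewrite -[leRHS](p_sum y) (le_trans (taboo_le_step _ _)) => [//|//|].
by apply: ler_sum => z _; rewrite mulr1.
Qed.

Lemma avoid_antitone m n y : (m <= n)%N -> avoid n y <= avoid m y.
Proof.
move=> /subnK <-; elim: (n - m)%N => // k IH.
by rewrite addSn (le_trans (avoidS _ _)).
Qed.

Lemma avoid_le1 n y : avoid n y <= 1.
Proof. exact: (@avoid_antitone 0). Qed.

(** One transition of positive probability towards a state from which [x] may be
    hit, or towards [x] itself, costs the probability of avoidance some mass. *)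
Lemma avoid_step n y z : z \in nb y -> 0 < p y z ->
  (z != x -> avoid n z < 1) -> avoid n.+1 y < 1.
Proof.
move=> zy pz av; rewrite -(p_sum y) /= /taboo -/(avoid n) big_mkcond /=.
have key w : (if w != x then p y w * avoid n w else 0) <= p y w.
  by case: ifP => // _; rewrite ler_piMr ?avoid_le1.
rewrite [ltLHS](big_rem z) // [ltRHS](big_rem z) //=.
apply: ltr_leD; last exact: ler_sum.
by case: ifP => // zx; rewrite gtr_pMr// av.
Qed.

Lemma avoid_lt1_of_path s y : (forall u v, 0 < p u v -> v \in nb u) ->
  path (fun u v => 0 < p u v) y s -> s != [::] -> last y s = x ->
  exists n, avoid n y < 1.
Proof.
move=> supp; elim: s y => // z s IH y /= /andP[pz ps] _ lx.
have [s0|sn] := eqVneq s [::].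
  exists 1%N; apply: (@avoid_step _ _ z) => //; first exact: supp.
  by rewrite s0 /= in lx; rewrite lx eqxx.
have [n nP] := IH _ ps sn lx.
by exists n.+1; apply: (@avoid_step _ _ z) => //; exact: supp.
Qed.

(** Foster's criterion.  The drift of [f] is only controlled off [F]; on [F], one
    adds a large multiple of [U = avoid 0 + ... + avoid (K - 1)], for which
    [taboo U - U = avoid K - 1] is never positive, and is bounded away from 0 on
    the finite set [F] once [K] is large.  The combination [G] satisfies
    [1 + taboo G <= G] everywhere, hence dominates all partial sums of
    [avoid]. *)
Lemma avoid_summable (f : E -> R) (F : seq E) (eps : R) :
  0 < eps -> (forall y, 0 <= f y) ->
  (forall y, y \notin F -> \sum_(z <- nb y) p y z * f z <= f y - eps) ->
  (forall y, exists n, avoid n y < 1) ->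
  exists C, forall n, \sum_(k < n) avoid k x <= C.
Proof.
move=> eps0 f0 drift hit.
have [K [delta delta0 hitF]] : exists K, exists2 delta, 0 < delta &
    forall y, y \in F -> avoid K y <= 1 - delta.
  elim: F {drift} => [|y F [K [delta delta0 IH]]]; first by exists 0%N, 1.
  have [n yn] := hit y.
  exists (maxn n K), (Num.min delta (1 - avoid n y)).
    by rewrite lt_min delta0 subr_gt0.
  move=> z; rewrite inE => /predU1P[->|zF].
    apply: (le_trans (avoid_antitone _ (leq_maxl _ _))).
    by rewrite lerBrDr -lerBrDl ge_min lexx orbT.
  apply: (le_trans (avoid_antitone _ (leq_maxr n _))).
  apply: (le_trans (IH _ zF)).
  by rewrite lerD2l lerN2 ge_min lexx.
pose b y := \sum_(z <- nb y) p y z * f z.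
have [B B0 bB] : exists2 B, 0 <= B & forall y, y \in F -> b y <= f y + B.
  exists (\sum_(y <- F) b y); first by do 2![apply: sumr_ge0 => ? _]; rewrite mulr_ge0.
  move=> y yF; rewrite (big_rem y) //= addrCA lerDl addr_ge0 //.
  by do 2![apply: sumr_ge0 => ? _]; rewrite mulr_ge0.
pose U y := \sum_(k < K) avoid k y.
have VU y : taboo U y = U y + avoid K y - 1.
  rewrite taboo_sum /U; apply/eqP; rewrite eq_sym subr_eq eq_sym addrC; apply/eqP.
  by rewrite -(big_ord_recr K (fun k => avoid k y)) big_ord_recl.
pose c1 := eps^-1; pose c2 := (1 + c1 * B) / delta.
have c10 : 0 <= c1 by rewrite invr_ge0 ltW.
have c20 : 0 <= c2 by rewrite divr_ge0 ?(ltW delta0)// addr_ge0// mulr_ge0.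
pose G y := c1 * f y + c2 * U y.
have U0 y : 0 <= U y by apply: sumr_ge0 => k _; exact: avoid_ge0.
have G0 y : 0 <= G y by rewrite addr_ge0// mulr_ge0.
have VG y : 1 + taboo G y <= G y.
  rewrite tabooD !tabooZ VU.
  have Vf := taboo_le_step y f0.
  have aK := avoid_le1 K y.
  (* On F the increase of c1 * f is absorbed by c2 * U; off F it is f itself
     that decreases, by eps, and c1 = 1 / eps. *)
  have [yF|yF] := boolP (y \in F).
    have h1 : c1 * taboo f y <= c1 * (f y + B).
      by rewrite ler_wpM2l// (le_trans Vf)// bB.
    have h2 : c2 * (U y + avoid K y - 1) <= c2 * (U y - delta).
      by rewrite ler_wpM2l//; have := hitF _ yF; lra.
    have h3 : c2 * delta = 1 + c1 * B by rewrite mulfVK// gt_eqF.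
    rewrite /G; lra.
  have h1 : c1 * taboo f y <= c1 * (f y - eps).
    by rewrite ler_wpM2l// (le_trans Vf)// drift.
  have h2 : c2 * (U y + avoid K y - 1) <= c2 * U y by rewrite ler_wpM2l//; lra.
  have h3 : c1 * eps = 1 by rewrite mulVf// gt_eqF.
  rewrite /G; lra.
(* The partial sums S_n satisfy S_(n+1) = 1 + taboo S_n. *)
exists (G x) => n; elim: n x => [|n IH] y; first by rewrite big_ord0.
rewrite big_ord_recl /= (le_trans _ (VG y))// lerD2l.
by rewrite -[leLHS](taboo_sum n avoid); exact: taboo_le.
Qed.

(** If [f] is a submartingale that vanishes at [x], killing at [x] does not affect
    it, so [taboo^n f x] stays above the mean of [f] after one step.  As the
    increments of [f] are at most [B], it is also at most
    [n B] times the probability of survival. *)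
Lemma avoid_lower_bound (f : E -> R) (B : R) (n : nat) :
  f x = 0 -> (forall y, f y <= \sum_(z <- nb y) p y z * f z) ->
  (forall y z, z \in nb y -> f z <= f y + B) ->
  \sum_(z <- nb x) p x z * f z <= n.+1%:R * B * avoid n.+1 x.
Proof.
move=> fx sub incr.
have Vf y : taboo f y = \sum_(z <- nb y) p y z * f z.
  rewrite [RHS](bigID (fun z => z != x)) /= [X in _ + X]big1 ?addr0//.
  by move=> z /negPn/eqP->; rewrite fx mulr0.
have fV m y : f y <= iter m taboo f y.
  elim: m y => //= m IH y; rewrite (le_trans (sub y))// -Vf.
  exact: taboo_le.
have Vup m y : iter m taboo f y <= (f y + m%:R * B) * avoid m y.
  elim: m y => [|m IH] y; first by rewrite mul0r addr0 mulr1.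
  rewrite /= -tabooZ /taboo big_seq_cond [leRHS]big_seq_cond.
  apply: ler_sum => z /andP[zy _]; rewrite ler_wpM2l// (le_trans (IH z))//.
  rewrite ler_wpM2r ?avoid_ge0//.
  by have := incr _ _ zy; rewrite -natr1; lra.
have := Vup n.+1 x; rewrite fx add0r; apply: le_trans.
by rewrite -Vf /=; exact: taboo_le.
Qed.

End Taboo.

Local Open Scope classical_set_scope.

(** * Cylinder events of the minimal construction *)

Section Fibers.
Variables (R : realType) (E : countType) (d : measure_display).
Variables (Omega : measurableType d) (mu : probability Omega R).
Variable f : Omega -> E.

(** [negligibleP] restated for the coercion of a probability to a set
    function, so that it can be rewritten with. *)
Lemma probability_negligibleP A : measurable A ->
  mu.-negligible A <-> mu A = 0%E.
Proof. exact: negligibleP. Qed.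

Lemma negligible_fibers A :
  (forall z, mu.-negligible (A `&` f @^-1` [set z])) -> mu.-negligible A.
Proof.
move=> Af.
pose F k := if unpickle k is Some z then A `&` f @^-1` [set z] else set0.
apply: (@negligibleS _ _ _ _ (\bigcup_k F k)).
  by move=> w Aw; exists (pickle (f w)) => //; rewrite /F pickleK.
apply: negligible_bigcup => k; rewrite /F.
by case: unpickle => // ; exact: negligible_set0.
Qed.

(** As the values off [s] only cost a null event, finite additivity suffices and
    no sum over the whole of [E] appears. *)
Lemma measure_fibers s S : (forall z, measurable (f @^-1` [set z])) ->
  measurable S -> uniq s -> mu.-negligible (S `&` [set w | f w \notin s]) ->
  mu S = (\sum_(z <- s) mu (S `&` f @^-1` [set z]))%E.
Proof.
move=> mf; elim: s S => [|z s IH] S mS.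
  move=> _ S0; rewrite big_nil; apply/(probability_negligibleP mS).
  by apply: negligibleS S0.
move=> /= /andP[zs us] S0; rewrite big_cons.
have -> : mu S = (mu (S `\` f @^-1` [set z]) + mu (S `&` f @^-1` [set z]))%E.
  exact: measureDI.
rewrite addeC.
congr (_ + _)%E; rewrite IH//; last 2 first.
- exact: measurableD.
- apply: negligibleS S0 => w [[Sw fz] /= fs]; split=> //=.
  by rewrite inE negb_or fs andbT; apply/eqP.
rewrite [LHS]big_seq [RHS]big_seq; apply: eq_bigr => y ys; congr (mu _).
apply/seteqP; split=> w /=; first by move=> [[Sw _] fy]; split.
move=> [Sw fy]; split=> //; split=> //= fz.
by move: zs; rewrite -fz fy ys.
Qed.

End Fibers.

Section Cylinders.
Variables (R : realType) (E : countType) (q : E -> E -> R).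
Variables (d : measure_display) (Omega : measurableType d).
Variable X : minimal_process q Omega.

Definition cylinder (y : nat -> E) (m : nat) : set Omega :=
  [set w | forall i, (i <= m)%N -> chain X i w = y i].

Definition held_beyond (s : R) (n : nat) : set Omega :=
  [set w | (s%:E < hold X n w)%E].

Definition avoids (x : E) (m n : nat) : set Omega :=
  [set w | forall i, (m < i <= n)%N -> chain X i w != x].

Definition path_weight (y : nat -> E) (m : nat) : R :=
  \prod_(i < m) jump_prob q (y i) (y i.+1).

Lemma measurable_held_beyond s n : measurable (held_beyond s n).
Proof.
rewrite -[held_beyond s n]setTI.
by apply: emeasurable_fun_o_infty => //; exact: measurable_hold.
Qed.

Lemma measurable_cylinder y m : measurable (cylinder y m).
Proof.
rewrite (_ : cylinder y m =
    \bigcap_(i in [set i | (i <= m)%N]) chain X i @^-1` [set y i]).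
  by apply: bigcap_measurableType => i _; exact: measurable_chain.
by apply/seteqP; split.
Qed.

Lemma measurable_avoids x m n : measurable (avoids x m n).
Proof.
rewrite (_ : avoids x m n =
    \bigcap_(i in [set i | (m < i <= n)%N]) ~` (chain X i @^-1` [set x])).
  apply: bigcap_measurableType => i _; apply: measurableC.
  exact: measurable_chain.
by apply/seteqP; split=> w /= h i /h /eqP.
Qed.

(** The case of the defining law in which all holding times but the last are
    tested against 0, which they always exceed. *)
Lemma cylinder_held_law x y m s : 0 <= s ->
  prob X x (cylinder y m `&` held_beyond s m) =
  ((y 0%N == x)%:R * path_weight y m * expR (- (exit_rate q (y m) * s)))%:E.
Proof.
move=> s0; pose t i := if i == m then s else 0 : R.
have t0 i : 0 <= t i by rewrite /t; case: ifP.
have := chain_hold_law X x m y t0.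
rewrite big_ord_recr /= [X in _ * (X * _)]big1 ?mul1r.
  rewrite /t eqxx => <-; congr (prob X x _); apply/seteqP; split=> w /=.
    move=> [yw sw] i im; rewrite yw//; split=> //.
    by case: eqVneq => [->//|_]; exact: hold_gt0.
  move=> h; split=> [i /h[]//|].
  by have [_] := h _ (leqnn m); rewrite eqxx.
by move=> i _; rewrite /t ltn_eqF ?ltn_ord// mulr0 oppr0 expR0.
Qed.

Lemma cylinder_law x y m :
  prob X x (cylinder y m) = ((y 0%N == x)%:R * path_weight y m)%:E.
Proof.
have := cylinder_held_law x y m (lexx 0).
rewrite mulr0 oppr0 expR0 mulr1 => <-; congr (prob X x _).
by rewrite setIidl// => w _; exact: hold_gt0.
Qed.

Variable nb : E -> seq E.
Hypothesis nb_uniq : forall y, uniq (nb y).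
Hypothesis nb_supp : forall y z, z \notin nb y -> jump_prob q y z = 0.

Let extend (y : nat -> E) m z i := if (i <= m)%N then y i else z.

Let cylinder_extend y m z :
  cylinder y m `&` chain X m.+1 @^-1` [set z] = cylinder (extend y m z) m.+1.
Proof.
apply/seteqP; split=> w /=.
  move=> [yw zw] i; rewrite leq_eqVlt ltnS /extend => /predU1P[->|im].
    by rewrite ltnn.
  by rewrite im yw.
rewrite /extend => h; split=> [i im|]; first by rewrite h ?im// leqW.
by rewrite h// ltnn.
Qed.

Let path_weight_extend y m z :
  path_weight (extend y m z) m.+1 = path_weight y m * jump_prob q (y m) z.
Proof.
rewrite /path_weight big_ord_recr /= /extend leqnn ltnn; congr (_ * _).
by apply: eq_bigr => i _; rewrite (ltnW (ltn_ord i)) ltn_ord.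
Qed.

Lemma negligible_off_nb x y m : (prob X x).-negligible
  (cylinder y m `&` [set w | chain X m.+1 w \notin nb (y m)]).
Proof.
apply: (@negligible_fibers _ _ _ _ _ (chain X m.+1)) => z.
have [zn|zn] := boolP (z \in nb (y m)).
  rewrite (_ : _ `&` _ = set0); first exact: negligible_set0.
  by apply/seteqP; split=> w //= [[_ /negP wn] wz]; apply: wn; rewrite wz.
apply: (@negligibleS _ _ _ _ (cylinder (extend y m z) m.+1)).
  by rewrite -cylinder_extend => w /= [[]].
apply/probability_negligibleP; first exact: measurable_cylinder.
by rewrite cylinder_law path_weight_extend nb_supp// !mulr0.
Qed.

(** The Markov property at step [m], by induction on the length [j] of the
    excursion: the value of the chain at step [m + 1] is one of [nb (y m)] up to
    a null event, contributes nothing if it is [x], and otherwise prolongs the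
    cylinder by one step. *)
Lemma taboo_cylinder_law x0 x y m j s : 0 <= s ->
  prob X x0 (cylinder y m `&` avoids x m (m + j) `&` held_beyond s (m + j)) =
  ((y 0%N == x0)%:R * path_weight y m *
   iter j (taboo (jump_prob q) nb x) (fun z => expR (- (exit_rate q z * s)))
     (y m))%:E.
Proof.
move=> s0; elim: j y m => [|j IH] y m.
  rewrite addn0 /= -cylinder_held_law//; congr (prob X x0 (_ `&` _)).
  by rewrite setIidl// => w _ i /andP[mi im]; move: (leq_trans mi im); rewrite ltnn.
set S := _ `&` _ `&` _.
have mS : measurable S.
  apply: measurableI; last exact: measurable_held_beyond.
  by apply: measurableI; [exact: measurable_cylinder|exact: measurable_avoids].
rewrite (@measure_fibers _ _ _ _ _ (chain X m.+1) (nb (y m)))//; last 2 first.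
- by move=> z; exact: measurable_chain.
- by apply: negligibleS (negligible_off_nb x0 y m) => w [[[]]].
rewrite iterS {1}/taboo mulr_sumr -sumEFin [RHS]big_mkcond.
apply: eq_bigr => z _; case: eqVneq => [->|zx] /=.
  rewrite (_ : _ `&` _ = set0) ?measure0//.
  apply/seteqP; split=> w //= [[[_ av] _] xw].
  have := av m.+1; rewrite xw eqxx ltnSn addnS ltnS leq_addr.
  by move=> /(_ isT).
rewrite (_ : _ `&` _ = cylinder (extend y m z) m.+1 `&`
    avoids x m.+1 (m.+1 + j) `&` held_beyond s (m.+1 + j)).
  rewrite IH path_weight_extend /extend leq0n ltnn.
  by rewrite -!mulrA.
rewrite -cylinder_extend addSnnS; apply/seteqP; split=> w /=.
  move=> [[[cw av] hw] zw]; do !split => //.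
  by move=> i /andP[mi ij]; apply: av; rewrite ij ltnW.
move=> [[[cw zw] av] hw]; do !split => //.
move=> i /andP[mi ij]; have [->|im] := eqVneq i m.+1; first by rewrite zw.
by apply: av; rewrite ij ltn_neqAle eq_sym im mi.
Qed.

Lemma avoids_held_law x n s : 0 <= s ->
  prob X x (avoids x 0 n `&` held_beyond s n) =
  (iter n (taboo (jump_prob q) nb x) (fun z => expR (- (exit_rate q z * s)))
     x)%:E.
Proof.
move=> s0; have := taboo_cylinder_law x x (fun=> x) 0 n s0.
rewrite add0n eqxx /path_weight big_ord0 !mul1r => <-.
set C := cylinder _ _.
have mC : measurable C := measurable_cylinder _ _.
rewrite -setIA [C `&` _]setIC.
have mS : measurable (avoids x 0 n `&` held_beyond s n).
  by apply: measurableI; [exact: measurable_avoids|exact: measurable_held_beyond].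
rewrite -[RHS]add0e; have <- : prob X x (avoids x 0 n `&` held_beyond s n `\` C) = 0%E.
  apply/(negligibleP _ (measurableD mS mC)).
  apply: (@negligibleS _ _ _ _ (~` C)); first by move=> w [].
  apply/probability_negligibleP; first exact: measurableC.
  rewrite probability_setC// cylinder_law eqxx /path_weight big_ord0 mulr1.
  by rewrite subee.
exact: measureDI.
Qed.

End Cylinders.

(** * Comparison of the return time with counting series *)

Section Counting.
Variable R : realType.
Local Open Scope ereal_scope.

(** Monotonicity of the integral without measurability, as needed for the return
    time, which is an infimum over uncountably many times. *)
Lemma le_integral_ge0 (d : measure_display) (T : measurableType d)
    (mu : {measure set T -> \bar R}) (f g : T -> \bar R) :
  (forall w, 0 <= f w) -> (forall w, f w <= g w) ->
  \int[mu]_w f w <= \int[mu]_w g w.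
Proof.
move=> f0 fg.
have g0 w : 0 <= g w by exact: le_trans (fg w).
rewrite !ge0_integralTE//; apply: ge_ereal_sup => _ [h hf <-].
apply: ereal_sup_ubound; exists h => // w; exact: le_trans (fg w).
Qed.

Lemma min_le_sum_lt (h : \bar R) n : 0 <= h ->
  Order.min n%:R%:E h <= \sum_(k < n) (if k%:R%:E < h then 1 else 0 : \bar R).
Proof.
move=> h0; elim: n => [|n IH]; first by rewrite big_ord0 ge_min lexx.
rewrite big_ord_recr /=; case: ifPn => [nh|].
  rewrite min_l ?(ltW nh)// in IH.
  by rewrite ge_min -natr1 EFinD leeD2r.
rewrite -leNgt adde0 => hn; rewrite min_r// in IH.
by rewrite ge_min IH orbT.
Qed.

(** Counting the integers below a holding time replaces the integral of its tail
    probabilities by a geometric series. *)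
Lemma le_nneseries_lt (h : \bar R) : 0 <= h ->
  h <= \sum_(k <oo) (if k%:R%:E < h then 1 else 0 : \bar R).
Proof.
move=> h0; set S := \sum_(k <oo) _.
have SE n : Order.min n%:R%:E h <= S.
  apply: (le_trans (min_le_sum_lt n h0)); rewrite /S.
  rewrite -(big_mkord xpredT (fun k => if k%:R%:E < h then 1 else 0 : \bar R)).
  by apply: nneseries_lim_ge => k _ _; case: ifP.
have [Sy|Sy] := eqVneq S +oo; first by rewrite Sy leey.
have Sfin : S \is a fin_num.
  rewrite fin_numE Sy andbT gt_eqF// (@lt_le_trans _ _ 0)//.
  by rewrite nneseries_ge0// => k _ _; case: ifP.
have := SE (Num.truncn (fine S)).+1; rewrite ge_min => /orP[|//].
by rewrite -[leRHS](fineK Sfin) lee_fin leNgt truncnS_gt.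
Qed.

End Counting.

Section Return.
Variables (R : realType) (E : countType) (q : E -> E -> R).
Variables (d : measure_display) (Omega : measurableType d).
Variable X : minimal_process q Omega.
Local Open Scope ereal_scope.

Lemma jump_timeS n w : jump_time X n.+1 w = jump_time X n w + hold X n w.
Proof. by rewrite /jump_time big_ord_recr. Qed.

Lemma jump_time_ge0 n w : 0 <= jump_time X n w.
Proof. by apply: sume_ge0 => i _; exact/ltW/hold_gt0. Qed.

Lemma le_jump_time m n w : (m <= n)%N -> jump_time X m w <= jump_time X n w.
Proof.
move=> /subnK <-; elim: (n - m)%N => // k IH.
by rewrite addSn jump_timeS (le_trans IH)// leeDl// ltW// hold_gt0.
Qed.

(** Holding times are positive, so the intervals between jumps are disjoint and
    the choice made in the definition of the path is forced. *)
Lemma path_between_jumps m t w :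
  jump_time X m w <= t%:E < jump_time X m.+1 w -> Defs.path X t w = Some (chain X m w).
Proof.
move=> mt; rewrite /Defs.path; set S := [set s | _].
have /(@xgetPex _ None)[n nt ->] : exists s, S s.
  by exists (Some (chain X m w)), m.
have [mn|nm|->//] := ltngtP n m.
- have /andP[_ tn] := nt; have /andP[tm _] := mt.
  by have := lt_le_trans tn (le_trans (le_jump_time w mn) tm); rewrite ltxx.
- have /andP[tn _] := nt; have /andP[_ tm] := mt.
  by have := lt_le_trans tm (le_trans (le_jump_time w nm) tn); rewrite ltxx.
Qed.

Lemma path_SomeP t w y : Defs.path X t w = Some y ->
  exists2 n, jump_time X n w <= t%:E < jump_time X n.+1 w & chain X n w = y.
Proof.
rewrite /Defs.path; set S := [set s | _].
have [Sex|SN] := pselect (exists s, S s).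
  by have [n nt ->] := @xgetPex _ None S Sex; case=> <-; exists n.
by rewrite xgetPN// => s Ss; apply: SN; exists s.
Qed.

Variable x : E.
Let away n s := avoids X x 0 n `&` held_beyond X s n.

Lemma return_time_ge0 w : 0 <= return_time X x w.
Proof.
apply: le_ereal_inf_tmp => _ [t [J1 _] <-].
exact: le_trans (jump_time_ge0 1 w) J1.
Qed.

Let indicE (A : set Omega) w : (\1_A w : R)%:E = (if w \in A then 1 else 0 : \bar R).
Proof. by rewrite indicE; case: (w \in A). Qed.

(** A return at the [m]-th jump takes at least the first [m] holding times, and
    the events counted are impossible from index [m] on. *)
Lemma return_time_ge w :
  \sum_(n <oo) (\1_(away n 1) w)%:E <= return_time X x w.
Proof.
apply: le_ereal_inf_tmp => _ [t [J1 /path_SomeP[m /andP[Jm Jm1] xm]] <-].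
have m0 : (0 < m)%N.
  case: m Jm1 {Jm xm} => // /(le_lt_trans J1); by rewrite ltxx.
rewrite (@nneseries_split _ _ 0%N m); last by move=> k _; rewrite lee_fin.
rewrite add0n [X in _ + X]eseries0 ?adde0; last first.
  move=> n mn _; rewrite indicE memNset//= => -[av _].
  by have := av m; rewrite m0 mn xm eqxx => /(_ isT).
rewrite (le_trans _ Jm)// /jump_time -(big_mkord xpredT (fun n => hold X n w)).
apply: lee_sum => n _; rewrite indicE; case: ifPn => [|_].
  by rewrite inE => -[_ /ltW].
exact/ltW/hold_gt0.
Qed.

(** If the chain first returns at step [m], the return time is at most the [m]-th
    jump time, to which each holding time contributes at most the number of
    integers below it.  If it never returns, the terms with [k = 0] already
    make the series infinite. *)
Lemma return_time_le w :
  return_time X x w <= \sum_(n <oo) \sum_(k <oo) (\1_(away n k%:R) w)%:E.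
Proof.
have S0 n k : (0 <= k)%N -> xpredT k -> 0 <= (\1_(away n k%:R) w : R)%:E.
  by move=> _ _; rewrite lee_fin.
have SS0 n : 0 <= \sum_(k <oo) (\1_(away n k%:R) w : R)%:E.
  by apply: nneseries_ge0 => k; exact: S0.
have holdE n : avoids X x 0 n w ->
    hold X n w <= \sum_(k <oo) (\1_(away n k%:R) w)%:E.
  move=> av; apply: (le_trans (le_nneseries_lt (ltW (hold_gt0 X n w)))).
  apply: lee_nneseries; first by move=> k _ _; case: ifP.
  by move=> k _; rewrite indicE; case: ifPn => [kh|_]; [rewrite mem_set|case: ifP].
have [[m0 Pm0]|none] := pselect (exists m, (0 < m)%N && (chain X m w == x)).
  have exm : exists m, (0 < m)%N && (chain X m w == x) by exists m0.
  case: (ex_minnP exm) => m /andP[mgt0 /eqP xm] mmin {m0 Pm0 exm}.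
  apply: (@le_trans _ _ (jump_time X m w)).
    have [->|Jy] := eqVneq (jump_time X m w) +oo; first by rewrite leey.
    have Jfin : jump_time X m w \is a fin_num.
      by rewrite ge0_fin_numE ?jump_time_ge0// ltey.
    apply: ereal_inf_lbound => /=; exists (fine (jump_time X m w)); last by rewrite fineK.
    split; first by rewrite fineK// le_jump_time.
    rewrite (@path_between_jumps m) ?xm// fineK// lexx jump_timeS.
    by rewrite lteDl// hold_gt0.
  rewrite (@nneseries_split _ _ 0%N m)// add0n.
  rewrite (le_trans _ (leeDl _ _))//; last exact: nneseries_ge0.
  rewrite big_mkord; apply: lee_sum => n _; apply: holdE => i /andP[i0 im].
  apply/negP => xi; have := mmin i; rewrite i0 xi => /(_ isT).
  by rewrite leqNgt (leq_ltn_trans im).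
apply: (@le_trans _ _ +oo); first by rewrite leey.
have av n : avoids X x 0 n w.
  by move=> i /andP[i0 _]; apply/negP => xi; apply: none; exists i; rewrite i0.
apply: (@le_trans _ _ (\sum_(n <oo) 1)).
  have := le_nneseries_lt (@le0y R).
  by under eq_eseriesr do rewrite ltry.
apply: lee_nneseries => // n _.
rewrite (le_trans _ (@nneseries_lim_ge _ _ xpredT 0 1 (S0 n)))//.
rewrite big_nat1 indicE mem_set//; split=> //=.
exact: hold_gt0.
Qed.

End Return.

(** * Mean return times and the taboo operator *)

Lemma nneseries_le_bound (R : realType) (u : nat -> R) (C : R) :
  (forall n, 0 <= u n) -> (forall n, \sum_(i < n) u i <= C) ->
  (\sum_(i <oo) (u i)%:E <= C%:E)%E.
Proof.
move=> u0 uC; apply: lime_le.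
  by apply: is_cvg_nneseries => n _ _; rewrite lee_fin.
by apply: nearW => n; rewrite sumEFin lee_fin big_mkord.
Qed.

Section Recurrence.
Variables (R : realType) (E : countType) (q : E -> E -> R).
Variables (d : measure_display) (Omega : measurableType d).
Variable X : minimal_process q Omega.
Variable nb : E -> seq E.
Hypothesis nb_uniq : forall y, uniq (nb y).
Hypothesis nb_supp : forall y z, z \notin nb y -> jump_prob q y z = 0.
Hypothesis jump_ge0 : forall y z, 0 <= jump_prob q y z.
Variable x : E.

Let away n s := avoids X x 0 n `&` held_beyond X s n.

Let measurable_away n s : measurable (away n s).
Proof.
by apply: measurableI; [exact: measurable_avoids|exact: measurable_held_beyond].
Qed.

Let integral_away n s :
  (\int[prob X x]_w (\1_(away n s) w)%:E = prob X x (away n s))%E.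
Proof. by rewrite integral_indic// setIT. Qed.

Let measurable_indic_away n s : measurable_fun setT (fun w => (\1_(away n s) w : R)%:E).
Proof. by apply/measurable_EFinP; exact: measurable_indic. Qed.

Let avoidE := avoid (jump_prob q) nb x.

(** Exit rates at least [a] make the holding times at most geometric: the double
    series is bounded by the product of the sum of [avoid] with a geometric
    series. *)
Lemma return_time_finite (a C : R) : 0 < a -> (forall y, a <= exit_rate q y) ->
  (forall n, \sum_(k < n) avoid (jump_prob q) nb x k x <= C) ->
  (\int[prob X x]_w return_time X x w < +oo)%E.
Proof.
move=> a0 qa avC.
set r := expR (- a).
have r0 : 0 <= r by exact: expR_ge0.
have r1 : 0 < 1 - r by rewrite subr_gt0 expR_lt1 oppr_lt0.
have PB n k : (prob X x (away n k%:R) <= (avoidE n x * r ^+ k)%:E)%E.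
  rewrite (avoids_held_law X nb_uniq nb_supp)// lee_fin mulrC -taboo_iterZ.
  apply: taboo_iter_le => // y; rewrite mulr1 /r -expRM_natr ler_expR -mulNr.
  by rewrite ler_wpM2r// lerN2.
have C0 : 0 <= C by have := avC 0%N; rewrite big_ord0.
apply: (@le_lt_trans _ _ (C / (1 - r))%:E); last exact: ltry.
apply: (le_trans (le_integral_ge0 _ (return_time_ge0 X x) (return_time_le X x))).
rewrite integral_nneseries//=; last 2 first.
- move=> n; refine (@ge0_emeasurable_sum _ _ _ _ _ xpredT _ _) => [k w _ _|k _].
    by rewrite lee_fin.
  exact: measurable_indic_away.
- by move=> n w _; apply: nneseries_ge0 => k _ _; rewrite lee_fin.
apply: (@le_trans _ _ (\sum_(n <oo) (avoidE n x / (1 - r))%:E)%E); last first.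
  apply: nneseries_le_bound => n.
    by rewrite divr_ge0 ?avoid_ge0 ?(ltW r1).
  by rewrite -mulr_suml ler_wpM2r ?invr_ge0 ?(ltW r1).
apply: lee_nneseries => n *.
  apply: integral_ge0 => w _.
  by apply: nneseries_ge0 => k _ _; rewrite lee_fin.
rewrite integral_nneseries//=; last by move=> k; exact: measurable_indic_away.
apply: (@le_trans _ _ (\sum_(k <oo) (avoidE n x * r ^+ k)%:E)%E).
  apply: lee_nneseries => k *; first exact: integral_ge0.
  by rewrite integral_away.
apply: nneseries_le_bound => k.
  by rewrite mulr_ge0 ?avoid_ge0 ?exprn_ge0.
rewrite -mulr_sumr ler_wpM2l ?avoid_ge0// -[leRHS]mul1r ler_pdivlMr//.
have := subrX1 r k; have := exprn_ge0 k r0; lra.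
Qed.

(** Exit rates at most [b] make each holding time exceed 1 with probability at
    least [expR (- b)], whatever the excursion; the mean return time then
    dominates a multiple of the harmonic series. *)
Lemma return_time_infinite (b c : R) : (forall y, exit_rate q y <= b) -> 0 < c ->
  (forall n, c <= n.+1%:R * avoid (jump_prob q) nb x n.+1 x) ->
  ~ (\int[prob X x]_w return_time X x w < +oo)%E.
Proof.
move=> qb c0 avc fin.
set I := (\int[prob X x]_w return_time X x w)%E in fin.
have I0 : (0 <= I)%E by apply: integral_ge0 => w _; exact: return_time_ge0.
have Ifin : I \is a fin_num by rewrite ge0_fin_numE.
set c' := c * expR (- b).
have c'0 : 0 < c' by rewrite mulr_gt0 ?expR_gt0.
have PB n : ((c' / n.+1%:R)%:E <= prob X x (away n.+1 1))%E.
  rewrite (avoids_held_law X nb_uniq nb_supp)// lee_fin.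
  apply: (@le_trans _ _ (expR (- b) * avoidE n.+1 x)).
    rewrite /c' mulrC mulrA mulrC ler_wpM2l ?expR_ge0//.
    by rewrite ler_pdivrMl ?ltr0n// avc.
  rewrite -taboo_iterZ; apply: taboo_iter_le => // y.
  by rewrite !mulr1 ler_expR lerN2.
have bound N : \sum_(n < N) c' / n.+1%:R <= fine I.
  rewrite -lee_fin fineK//.
  apply: (@le_trans _ _ (\sum_(n <oo) prob X x (away n 1))%E); last first.
    rewrite -(eq_eseriesr (fun n _ => integral_away n 1)) -integral_nneseries//.
    apply: le_integral_ge0 => w; last exact: return_time_ge.
    by apply: nneseries_ge0 => k _ _; rewrite lee_fin.
  apply: (le_trans _ (@nneseries_lim_ge _ _ xpredT 0 N.+1 _)) => //.
  rewrite big_mkord big_ord_recl -sumEFin -[leLHS]add0e leeD//.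
  by apply: lee_sum.
apply: (@dvg_harmonic R); apply: nondecreasing_is_cvgn.
  apply: nondecreasing_series => n _ _; exact: harmonic_ge0.
exists (fine I / c') => _ [n _ <-].
rewrite ler_pdivlMr// /series /= mulr_suml big_mkord.
by apply: le_trans (bound n); apply: ler_sum => i _; rewrite mulrC.
Qed.

End Recurrence.

(** * Positive jump probabilities give positive transition probabilities *)

Section Irreducible.
Variables (R : realType) (E : countType) (q : E -> E -> R).
Variables (d : measure_display) (Omega : measurableType d).
Variable X : minimal_process q Omega.
Hypothesis exit_gt0 : forall y, 0 < exit_rate q y.
Hypothesis jump_ge0 : forall y z, 0 <= jump_prob q y z.
Hypothesis jump_le1 : forall y z, jump_prob q y z <= 1.

Lemma measurable_jump_time n : measurable_fun setT (jump_time X n).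
Proof.
by apply: emeasurable_sum => i; exact: measurable_hold.
Qed.

Lemma measurable_path_eq t y : measurable [set w | Defs.path X t w = Some y].
Proof.
pose S n := [set w | (jump_time X n w <= t%:E)%E] `&`
  [set w | (t%:E < jump_time X n.+1 w)%E] `&` chain X n @^-1` [set y].
rewrite (_ : [set w | _] = \bigcup_n S n).
  apply: bigcupT_measurable => n; apply: measurableI; last first.
    exact: measurable_chain.
  apply: measurableI.
    rewrite -[X in measurable X]setTI; apply: emeasurable_fun_infty_c => //.
    exact: measurable_jump_time.
  rewrite -[X in measurable X]setTI; apply: emeasurable_fun_o_infty => //.
  exact: measurable_jump_time.
apply/seteqP; split=> w /=.
  by move=> /path_SomeP[n /andP[Jt tJ] xy]; exists n.
move=> [n _ [[/= Jt tJ] xy]]; rewrite (@path_between_jumps _ _ _ _ _ _ n).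
  by rewrite xy.
by rewrite Jt.
Qed.

(** On a cylinder, the holding time exceeds [k] with probability at most
    [expR (- a k) <= 1 / (1 + a k)] for every [k], where [a] is the exit rate. *)
Lemma negligible_hold_infty x y n :
  (prob X x).-negligible (cylinder X y n `&` [set w | hold X n w = +oo%E]).
Proof.
set S := _ `&` _.
have mS : measurable S.
  apply: measurableI; first exact: measurable_cylinder.
  rewrite -[X in measurable X]setTI; exact: (measurable_hold X n _ (emeasurable_set1 _)).
apply/probability_negligibleP => //.
have Pfin : prob X x S \is a fin_num.
  by rewrite ge0_fin_numE// (le_lt_trans (probability_le1 _ mS)) ?ltry.
rewrite -(fineK Pfin); set v := fine _; congr (_%:E).
have v0 : 0 <= v by exact: fine_ge0.
set a := exit_rate q (y n); have a0 : 0 < a by exact: exit_gt0.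
have vk k : v * (1 + a * k%:R) <= 1.
  apply: (@le_trans _ _ (v * expR (a * k%:R))).
    by rewrite ler_wpM2l// expR_ge1Dx.
  have k0 : (0 : R) <= k%:R by [].
  rewrite mulrC -ler_pdivlMl ?expR_gt0// mulr1 -expRN -lee_fin /v fineK//.
  apply: (@le_trans _ _ (prob X x (cylinder X y n `&` held_beyond X k%:R n))).
    apply: le_measure; rewrite ?inE//.
      apply: measurableI; first exact: measurable_cylinder.
      exact: measurable_held_beyond.
    by move=> w [cw hw]; split=> //; rewrite /held_beyond /= hw ltry.
  rewrite cylinder_held_law// lee_fin ler_piMl ?expR_ge0// mulr_ile1//.
  - exact: prodr_ge0.
  - by case: eqP; rewrite ?ler01.
  - by apply: prodr_ile1 => i _; rewrite jump_ge0 jump_le1.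
apply/eqP; rewrite eq_le v0 andbT leNgt; apply/negP => vgt0.
have := vk (Num.truncn (v * a)^-1).+1.
rewrite leNgt => /negP; apply.
rewrite mulrDr mulr1 mulrA.
have va0 : 0 < v * a by rewrite mulr_gt0.
apply: (@lt_le_trans _ _ (v * a * (Num.truncn (v * a)^-1).+1%:R)); last by rewrite lerDr.
by rewrite mulrC -ltr_pdivrMr// div1r truncnS_gt.
Qed.

(** On the event that the chain follows [x :: s] and then stays at [y] for more
    than one unit of time, an event of positive probability, the process is at
    [y] at some integer time, unless one of the previous holding times is
    infinite, which is negligible.  Hence one of the countably many integer times
    has the required property. *)
Lemma path_positive x s y :
  path (fun u v => 0 < jump_prob q u v) x s -> last x s = y ->
  exists2 t : R, 0 <= t & (0 < prob X x [set w | Defs.path X t w = Some y])%E.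
Proof.
move=> xs sy; apply: contrapT => none.
have null t : 0 <= t ->
    (prob X x).-negligible [set w | Defs.path X t w = Some y].
  move=> t0; apply/probability_negligibleP; first exact: measurable_path_eq.
  apply/eqP; rewrite eq_le measure_ge0 andbT leNgt; apply/negP => Pt.
  by apply: none; exists t.
pose Y i := nth x (x :: s) i; pose n := size s.
have Yn : Y n = y by rewrite /Y /n nth_last /= -sy.
have PS : (0 < prob X x (cylinder X Y n `&` held_beyond X 1 n))%E.
  rewrite cylinder_held_law// lte_fin mulr_gt0 ?expR_gt0// /Y /= eqxx mul1r.
  by apply: prodr_gt0 => i _; have /(pathP x)/(_ i (ltn_ord i)) := xs.
suff : (prob X x).-negligible (cylinder X Y n `&` held_beyond X 1 n).
  move=> /probability_negligibleP P0; move: PS; rewrite P0 ?ltxx//.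
  apply: measurableI; first exact: measurable_cylinder.
  exact: measurable_held_beyond.
pose inf i := cylinder X Y i `&` [set w | hold X i w = +oo%E].
apply: (@negligibleS _ _ _ _ ((\bigcup_(k : nat) [set w | Defs.path X k%:R w = Some y])
    `|` \bigcup_i inf i)); last first.
  apply: negligibleU; apply: negligible_bigcup => k; first exact: null.
  exact: negligible_hold_infty.
move=> w [cw hw].
have [[i /andP[il hi]]|fin] := pselect (exists i, (i < n)%N && (hold X i w == +oo%E)).
  have {}hi := eqP hi.
  right; exists i => //; split; last exact: hi.
  by move=> j ji; exact: cw (leq_trans ji (ltnW il)).
left.
have Jlt : (jump_time X n w < +oo)%E.
  apply: lte_sum_pinfty => i _; rewrite ltey; apply/negP => hi.
  by apply: fin; exists i; rewrite ltn_ord.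
have Jfin : jump_time X n w \is a fin_num by rewrite ge0_fin_numE ?jump_time_ge0.
have J0 : 0 <= fine (jump_time X n w) by rewrite fine_ge0// jump_time_ge0.
have /andP[tJ Jt] := truncn_itv J0.
(* The first integer after the n-th jump falls within the last stay, which is
   longer than 1. *)
exists (Num.truncn (fine (jump_time X n w))).+1 => //=.
rewrite (@path_between_jumps _ _ _ _ _ _ n) ?(cw n)// ?Yn//.
rewrite jump_timeS -(fineK Jfin) lee_fin (ltW Jt) /=.
rewrite (@le_lt_trans _ _ ((fine (jump_time X n w))%:E + 1)%E)//.
  by rewrite -EFinD lee_fin -natr1 lerD2r.
by rewrite lteD2lE.
Qed.

End Irreducible.

(** * Rates of finite range *)

Section FiniteRange.
Variables (R : realType) (E : countType) (q : E -> E -> R) (nb : E -> seq E).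
Hypothesis nb_uniq : forall y, uniq (nb y).
Hypothesis q_supp : forall y z, z \notin nb y -> q y z = 0.
Hypothesis q_ge0 : forall y z, 0 <= q y z.
Hypothesis q_diag : forall y, q y y = 0.

Lemma exit_rateE y : exit_rate q y = \sum_(z <- nb y) q y z.
Proof.
rewrite /exit_rate.
have -> : (\esum_(z in [set z | z != y]) (q y z)%:E =
           \esum_(z in [set` nb y]) (q y z)%:E)%E.
  rewrite esum_mkcond [RHS]esum_mkcond; apply: eq_esum => z _.
  case: ifPn => zy; case: ifPn => zn //.
    by rewrite q_supp//; move: zn; rewrite notin_setE /= => /negP.
  by move: zy; rewrite notin_setE /= => /negP/negPn/eqP->; rewrite q_diag.
rewrite esum_fset//=; last by move=> z _; rewrite lee_fin.
by rewrite -fsbig_seq//= sumEFin.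
Qed.

Hypothesis exit_gt0 : forall y, 0 < exit_rate q y.

Lemma jump_probE y z : jump_prob q y z = q y z / exit_rate q y.
Proof.
rewrite /jump_prob gt_eqF//.
by case: eqVneq => // ->; rewrite q_diag mul0r.
Qed.

Lemma jump_prob_supp y z : z \notin nb y -> jump_prob q y z = 0.
Proof. by move=> zn; rewrite jump_probE q_supp// mul0r. Qed.

Lemma jump_prob_ge0 y z : 0 <= jump_prob q y z.
Proof. by rewrite jump_probE divr_ge0// ltW. Qed.

Lemma jump_prob_sum y : \sum_(z <- nb y) jump_prob q y z = 1.
Proof.
under eq_bigr do rewrite jump_probE.
by rewrite -mulr_suml -exit_rateE divff// gt_eqF.
Qed.

Lemma jump_prob_le1 y z : jump_prob q y z <= 1.
Proof.
have [zn|zn] := boolP (z \in nb y); last by rewrite jump_prob_supp.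
rewrite -(jump_prob_sum y) (big_rem z)//= lerDl.
by apply: sumr_ge0 => w _; exact: jump_prob_ge0.
Qed.

(** The one-step mean of the jump chain in terms of the generator of the
    process. *)
Lemma jump_mean (f : E -> R) y :
  \sum_(z <- nb y) jump_prob q y z * f z =
  f y + (\sum_(z <- nb y) q y z * (f z - f y)) / exit_rate q y.
Proof.
rewrite -[X in _ = X + _]mul1r -(jump_prob_sum y) !mulr_suml -big_split /=.
by apply: eq_bigr => z _; rewrite mulrAC -jump_probE mulrBr addrC subrK.
Qed.

End FiniteRange.

(** * The tandem system *)

Section Tandem.
Variables (R : realType) (lambda : nat -> R) (mu1 mu2 : R).
Hypothesis lambda_ge0 : forall n, 0 <= lambda n.
Hypothesis lambda0_gt0 : 0 < lambda 0%N.
Hypothesis lambda_nonincreasing : forall m n, (m <= n)%N -> lambda n <= lambda m.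
Hypothesis mu1_gt0 : 0 < mu1.
Hypothesis mu2_gt0 : 0 < mu2.

Notation q := (tandem_rate lambda mu1 mu2).

(** Because of the truncated predecessors, one or two entries carry rate 0 on the
    boundary; the three entries are distinct all the same, which spares a case
    distinction. *)
Definition tandem_nb (y : nat * nat) : seq (nat * nat) :=
  [:: (y.1.+1, y.2); (y.1.-1, y.2.+1); (y.1, y.2.-1)].

Lemma tandem_nb_uniq y : uniq (tandem_nb y).
Proof. by case: y => a b; rewrite /= !inE !xpair_eqE; lia. Qed.

Lemma tandem_rate_supp y z : z \notin tandem_nb y -> q y z = 0.
Proof.
rewrite !inE !negb_or => /and3P[/negbTE z1 /negbTE z2 /negbTE z3].
by rewrite /tandem_rate z1 z2 z3 !andbF.
Qed.

Lemma tandem_rate_ge0 y z : 0 <= q y z.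
Proof. by rewrite /tandem_rate; do 3?[case: ifP => _] => //; exact: ltW. Qed.

Lemma tandem_rate_diag y : q y y = 0.
Proof.
case: y => a b; rewrite /tandem_rate /= !xpair_eqE.
have -> : (a == a.+1) = false by lia.
have -> : (b == b.+1) = false by lia.
rewrite !andbF /=.
by have -> : (0 < b)%N && ((a == a) && (b == b.-1)) = false by lia.
Qed.

Lemma tandem_sum (g : nat * nat -> R) a b :
  \sum_(z <- tandem_nb (a, b)) q (a, b) z * g z =
  lambda b * g (a.+1, b) +
  (if (0 < a)%N then mu1 * g (a.-1, b.+1) else 0) +
  (if (0 < b)%N then mu2 * g (a, b.-1) else 0).
Proof.
rewrite !big_cons big_nil addr0 /= addrA.
have -> : q (a, b) (a.+1, b) = lambda b by rewrite /tandem_rate eqxx.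
have -> : q (a, b) (a.-1, b.+1) = if (0 < a)%N then mu1 else 0.
  rewrite /tandem_rate /= eqxx andbT !xpair_eqE.
  have -> : (b.+1 == b) = false by lia.
  have -> : (b.+1 == b.-1) = false by lia.
  by rewrite !andbF.
have -> : q (a, b) (a, b.-1) = if (0 < b)%N then mu2 else 0.
  rewrite /tandem_rate /= eqxx andbT !xpair_eqE.
  have -> : (a == a.+1) = false by lia.
  have -> : (b.-1 == b.+1) = false by lia.
  by rewrite !andbF.
by congr (_ + _ + _); case: ifP; rewrite ?mul0r.
Qed.

Lemma tandem_exit_rate a b : exit_rate q (a, b) =
  lambda b + (if (0 < a)%N then mu1 else 0) + (if (0 < b)%N then mu2 else 0).
Proof.
rewrite (exit_rateE tandem_nb_uniq tandem_rate_supp tandem_rate_ge0 tandem_rate_diag).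
have := tandem_sum (fun=> 1) a b; rewrite !mulr1 => <-.
by apply: eq_bigr => z _; rewrite mulr1.
Qed.

Lemma tandem_exit_rate_ge y :
  Num.min (lambda 0%N) (Num.min mu1 mu2) <= exit_rate q y.
Proof.
case: y => a b; rewrite tandem_exit_rate !ge_min.
have lb := lambda_ge0 b.
case: b lb => [|b] lb; case: a => [|a] /=; apply/orP; [left|right|right|right].
- by lra.
- by apply/orP; left; lra.
- by apply/orP; right; lra.
- by apply/orP; right; have := mu1_gt0; lra.
Qed.

Lemma tandem_exit_rate_gt0 y : 0 < exit_rate q y.
Proof.
by apply: lt_le_trans (tandem_exit_rate_ge y); rewrite !lt_min; apply/and3P.
Qed.

Lemma tandem_exit_rate_le y : exit_rate q y <= lambda 0%N + mu1 + mu2.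
Proof.
case: y => a b; rewrite tandem_exit_rate.
have lb := lambda_nonincreasing (leq0n b).
have m1 := mu1_gt0; have m2 := mu2_gt0.
by do 2![case: ifP => _]; lra.
Qed.

Let p_supp := jump_prob_supp tandem_rate_supp tandem_rate_diag tandem_exit_rate_gt0.
Let p_ge0 := jump_prob_ge0 tandem_rate_ge0 tandem_rate_diag tandem_exit_rate_gt0.
Let p_sum := jump_prob_sum tandem_nb_uniq tandem_rate_supp tandem_rate_ge0
  tandem_rate_diag tandem_exit_rate_gt0.
Let p_le1 := jump_prob_le1 tandem_nb_uniq tandem_rate_supp tandem_rate_ge0
  tandem_rate_diag tandem_exit_rate_gt0.

(** The generator of the process applied to [f], at the state [(a, b)]. *)
Definition tandem_drift (f : nat * nat -> R) (a b : nat) : R :=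
  lambda b * (f (a.+1, b) - f (a, b)) +
  (if (0 < a)%N then mu1 * (f (a.-1, b.+1) - f (a, b)) else 0) +
  (if (0 < b)%N then mu2 * (f (a, b.-1) - f (a, b)) else 0).

Lemma tandem_jump_mean (f : nat * nat -> R) a b :
  \sum_(z <- tandem_nb (a, b)) jump_prob q (a, b) z * f z =
  f (a, b) + tandem_drift f a b / exit_rate q (a, b).
Proof.
rewrite (jump_mean tandem_nb_uniq tandem_rate_supp tandem_rate_ge0
  tandem_rate_diag tandem_exit_rate_gt0).
by rewrite (tandem_sum (fun z => f z - f (a, b))).
Qed.

Let step : rel (nat * nat) := fun u v => 0 < jump_prob q u v.

Definition reaches u v := exists2 s, path step u s & last u s = v.

Lemma reaches_refl u : reaches u u.
Proof. by exists [::]. Qed.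

Lemma reaches_trans v u w : reaches u v -> reaches v w -> reaches u w.
Proof.
move=> [s us sv] [t vt tw]; exists (s ++ t); first by rewrite cat_path us sv.
by rewrite last_cat sv.
Qed.

Lemma step_reaches u v : 0 < q u v -> reaches u v.
Proof.
move=> uv; exists [:: v] => //=; rewrite andbT /step.
rewrite (jump_probE tandem_rate_diag tandem_exit_rate_gt0) divr_gt0//.
exact: tandem_exit_rate_gt0.
Qed.

Lemma arrival_reaches a : reaches (a, 0%N) (a.+1, 0%N).
Proof. by apply: step_reaches; rewrite /tandem_rate eqxx. Qed.

Lemma service1_reaches a b : reaches (a.+1, b) (a, b.+1).
Proof.
apply: step_reaches; rewrite /tandem_rate /= eqxx !xpair_eqE.
have -> : (b.+1 == b) = false by lia.
by rewrite andbF.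
Qed.

Lemma service2_reaches a b : reaches (a, b.+1) (a, b).
Proof.
apply: step_reaches; rewrite /tandem_rate /= eqxx !xpair_eqE.
have -> : (a == a.+1) = false by lia.
have -> : (b == b.+2) = false by lia.
by rewrite !andbF.
Qed.

(** Empty the second queue, then move the customers of the first one through the
    second one by one. *)
Lemma reaches_empty y : reaches y (0%N, 0%N).
Proof.
have drain a b : reaches (a, b) (a, 0%N).
  elim: b => [|b IH]; first exact: reaches_refl.
  exact: reaches_trans (service2_reaches a b) IH.
case: y => a b; elim: a b => [|a IH] b; first exact: drain.
apply: reaches_trans (drain _ b) _.
exact: reaches_trans (service1_reaches a 0) (IH 1%N).
Qed.

(** All arrivals take place while the second queue is empty, since [lambda 0] is
    the only arrival rate known to be positive. *)
Lemma empty_reaches y : reaches (0%N, 0%N) y.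
Proof.
case: y => a b; apply: (@reaches_trans (a + b, 0)%N).
  elim: (a + b)%N => [|n IH]; first exact: reaches_refl.
  exact: reaches_trans IH (arrival_reaches n).
elim: b a => [|b IH] a; first by rewrite addn0; exact: reaches_refl.
rewrite addnS -addSn; exact: reaches_trans (IH a.+1) (service1_reaches a b).
Qed.

(** The detour through an arrival at the empty system makes the path nonempty
    even if [y = x]. *)
Lemma tandem_hits x y :
  exists n, avoid (jump_prob q) tandem_nb x n y < 1.
Proof.
have [s ys s0] := reaches_empty y.
have [t st t1] := arrival_reaches 0.
have t0 : t != [::] by apply/eqP => t0; move: t1; rewrite t0.
have [r tr rx] : reaches (1%N, 0%N) x.
  exact: reaches_trans (reaches_empty _) (empty_reaches x).
apply: (@avoid_lt1_of_path _ _ _ _ p_ge0 p_sum x (s ++ t ++ r)).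
- move=> u v uv; apply: contraT => /p_supp uv0; move: uv; rewrite uv0 ltxx.
  by [].
- by rewrite !cat_path ys s0 st t1.
- by move: t0; case: (s) => //; case: (t).
- by rewrite !last_cat s0 t1.
Qed.

Section Realization.
Variables (d : measure_display) (Omega : measurableType d).
Variable X : minimal_process q Omega.

Lemma tandem_irreducible : irreducible X.
Proof.
move=> x y.
have [s xs sy] := reaches_trans (reaches_empty x) (empty_reaches y).
exact: (path_positive X tandem_exit_rate_gt0 p_ge0 p_le1 xs sy).
Qed.

(** Bounded exit rates turn a negative drift of the process into a negative drift
    of its jump chain. *)
Lemma tandem_recurrent (x : nat * nat) (f : nat * nat -> R)
    (F : seq (nat * nat)) (eps : R) :
  0 < eps -> (forall y, 0 <= f y) ->
  (forall a b, (a, b) \notin F -> tandem_drift f a b <= - eps) ->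
  (\int[prob X x]_w return_time X x w < +oo)%E.
Proof.
move=> eps0 f0 fF.
set b := lambda 0%N + mu1 + mu2.
have b0 : 0 < b by rewrite !addr_gt0.
have [C avC] : exists C, forall n,
    \sum_(k < n) avoid (jump_prob q) tandem_nb x k x <= C.
  apply: (@avoid_summable _ _ _ _ p_ge0 p_sum x f F (eps / b)) => //.
  - by rewrite divr_gt0.
  - move=> [a c] /fF dr; rewrite tandem_jump_mean lerD2l.
    have e0 := tandem_exit_rate_gt0 (a, c).
    rewrite ler_pdivrMr// (le_trans dr)// mulNr lerN2 mulrAC ler_pdivrMr//.
    rewrite ler_wpM2l ?(ltW eps0)//.
    exact: tandem_exit_rate_le.
  - exact: tandem_hits.
apply: (return_time_finite X tandem_nb_uniq p_supp p_ge0 _ tandem_exit_rate_ge avC).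
by rewrite !lt_min; apply/and3P.
Qed.

(** From the empty system the only possible jump is an arrival, so the mean of [f]
    after one step is positive. *)
Lemma tandem_not_recurrent (f : nat * nat -> R) B :
  f (0%N, 0%N) = 0 -> 0 < f (1%N, 0%N) -> 0 < B ->
  (forall a b, 0 <= tandem_drift f a b) ->
  (forall y z, z \in tandem_nb y -> f z <= f y + B) ->
  ~ (\int[prob X (0%N, 0%N)]_w return_time X (0%N, 0%N) w < +oo)%E.
Proof.
move=> f0 f1 B0 dr incr.
have sub y : f y <= \sum_(z <- tandem_nb y) jump_prob q y z * f z.
  case: y => a b; rewrite tandem_jump_mean lerDl divr_ge0// ltW//.
  exact: tandem_exit_rate_gt0.
have low n := avoid_lower_bound p_ge0 n f0 sub incr.
set c := \sum_(z <- _) _ in low.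
have c0 : 0 < c.
  rewrite /c tandem_jump_mean f0 add0r divr_gt0 ?tandem_exit_rate_gt0//.
  by rewrite /tandem_drift /= !addr0 f0 subr0 mulr_gt0.
have cB0 : 0 < c / B by rewrite divr_gt0.
apply: (return_time_infinite tandem_nb_uniq p_supp p_ge0 tandem_exit_rate_le cB0).
by move=> n; rewrite ler_pdivrMr// mulrAC; exact: low.
Qed.

End Realization.

(** The increments of [h] are [- e n] for [n < N] and [1 / 2] from [N] on.  Below
    [N] the recursion for [e] turns the second inequality into
    [lambda <= mu1]; all [e n] are proportional to [e 0], so they can be
    chosen so small that the change of slope at [N], where [lambda] already
    vanishes, is harmless.  The common gain is [eps = mu1 * e 0]. *)
Lemma queue2_correction N : (forall n, (N <= n)%N -> lambda n = 0) ->
  lambda 0%N <= mu1 ->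
  exists2 h : nat -> R, (forall n, 0 <= h n) & exists2 eps : R, 0 < eps & [/\
    lambda 0%N + mu1 * (h 1%N - h 0%N) <= mu1 - eps,
    forall n, lambda n.+1 + mu1 * (h n.+2 - h n.+1) + mu2 * (h n - h n.+1)
      <= mu1 - eps &
    forall n, (N <= n)%N -> lambda n.+1 + mu2 * (h n - h n.+1) <= - eps].
Proof.
move=> lN l0.
have N0 : (0 < N)%N.
  by rewrite lt0n; apply/eqP => N0; move: lambda0_gt0; rewrite lN ?ltxx// N0.
(* e n = eps * c n, where c solves the recursion with eps = 1. *)
have [e e_gt0 [e0m eS eN]] : exists2 e : nat -> R, forall n, 0 < e n &
    [/\ mu1 * e 0%N <= mu2 / 2, forall n, mu1 * e n.+1 = mu1 * e 0%N + mu2 * e n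
      & e N <= 1 / 2].
  pose c n := iter n (fun u => (1 + mu2 * u) / mu1) mu1^-1.
  have c_gt0 n : 0 < c n.
    elim: n => [|n IH]; rewrite /c /= ?invr_gt0//.
    by rewrite divr_gt0// addr_gt0// mulr_gt0.
  pose eps := Num.min (c N *+ 2)^-1 (mu2 / 2).
  have eps0 : 0 < eps by rewrite lt_min invr_gt0 mulrn_wgt0 ?divr_gt0.
  have e0E : mu1 * (eps * c 0%N) = eps.
    by rewrite /c /= mulrCA divff ?mulr1// gt_eqF.
  exists (fun n => eps * c n) => [n|]; first by rewrite mulr_gt0.
  split.
  - by rewrite e0E /eps ge_min lexx orbT.
  - move=> n; rewrite e0E mulrCA [mu1 * _]mulrC divfK ?gt_eqF//.
    by rewrite mulrDr mulr1 mulrCA.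
  - rewrite mul1r -ler_pdivlMr// -invfM mulrC mulr_natr.
    by rewrite /eps ge_min lexx.
pose dh n := if (n < N)%N then - e n else 1 / 2.
pose g n := \sum_(i < n) dh i.
have gS n : g n.+1 = g n + dh n by rewrite /g big_ord_recr.
(* g first decreases by the total of the e i with i < N, then increases. *)
have gK n : 0 <= g n + \sum_(i < N) e i.
  pose T n := \sum_(i < minn n N) e i.
  have TK : T n <= \sum_(i < N) e i.
    rewrite /T -!(big_mkord xpredT e).
    rewrite [leRHS](@big_cat_nat _ _ _ (minn n N)) ?geq_minr//=.
    by rewrite lerDl sumr_ge0// => i _; rewrite ltW.
  suff Tg : - T n <= g n by rewrite -(opprK (\sum_(i < N) e i)) subr_ge0 (le_trans _ Tg)// lerN2.
  elim: n {TK} => [|n IH]; first by rewrite /T min0n /g !big_ord0 oppr0.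
  rewrite gS /dh; case: ltnP => nN; last first.
    have -> : T n.+1 = T n by rewrite /T !(minn_idPr _)// leqW.
    by rewrite (le_trans IH)// lerDl.
  have -> : T n.+1 = T n + e n.
    by rewrite /T (minn_idPl nN) (minn_idPl (ltnW nN)) big_ord_recr.
  by rewrite opprD lerD2r.
exists (fun n => g n + \sum_(i < N) e i) => //.
exists (mu1 * e 0%N); first by rewrite mulr_gt0.
have gap m n : g m + \sum_(i < N) e i - (g n + \sum_(i < N) e i) = g m - g n.
  by rewrite opprD addrACA subrr addr0.
have inc n : g n.+1 - g n = dh n by rewrite gS addrC addKr.
have dec n : g n - g n.+1 = - dh n by rewrite -inc opprB.
split.
- by rewrite gap inc /dh N0 mulrN lerD2r.
- move=> n; rewrite !gap inc dec mulrN.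
  have ll : lambda n.+1 <= mu1 := le_trans (lambda_nonincreasing (leq0n n.+1)) l0.
  rewrite {2}/dh; case: ltnP => nN; last first.
    by rewrite /dh ltnNge leqW//= lN ?leqW//; have := mu2_gt0; have := mu1_gt0; lra.
  rewrite /dh; case: ltnP => nN'; first by have := eS n; lra.
  have nN1 : n.+1 = N by apply/eqP; rewrite eqn_leq nN nN'.
  have : mu1 * e n.+1 <= mu1 * (1/2) by rewrite ler_wpM2l ?(ltW mu1_gt0)// nN1.
  by rewrite lN//; have := eS n; lra.
- by move=> n nN; rewrite lN ?leqW// gap dec /dh ltnNge nN /=; lra.
Qed.

(** Off the axis [x1 = 0] the first two properties of the correction apply, and
    far up that axis the third one does. *)
Lemma negative_drift N : (forall n, (N <= n)%N -> lambda n = 0) ->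
  lambda 0%N <= mu1 ->
  exists2 f : nat * nat -> R, (forall y, 0 <= f y) &
  exists F : seq (nat * nat), exists2 eps : R, 0 < eps &
    forall a b, (a, b) \notin F -> tandem_drift f a b <= - eps.
Proof.
move=> lN l0; have [h h0 [eps eps0 [d0 d1 d2]]] := queue2_correction lN l0.
exists (fun y => y.1%:R + h y.2) => [y|]; first by rewrite addr_ge0.
exists [seq (0%N, n) | n <- iota 0 N.+1], eps => // a b abF.
rewrite /tandem_drift /=.
case: a abF => [|a] abF; last first.
  rewrite /= -!natr1; case: b {abF} => [|b] /=; first by lra.
  by have := d1 b; lra.
have [bN|] := leqP b N; first by move: abF; rewrite map_f// mem_iota.
by case: b {abF} => // b bN; have := d2 b bN; rewrite /=; lra.
Qed.

(** The drift is 0 at [(a, 0)] with [a > 0] by the choice of [c]; at [(a, b)] with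
    [a, b > 0] it is at least [- mu1 * (1 + c) + mu2 * c], and
    [mu1 * (1 + c) = lambda 0]. *)
Lemma positive_drift : mu1 < lambda 0%N ->
  let c := (lambda 0%N - mu1) / mu1 in
  lambda 0%N / c <= mu2 ->
  forall a b, 0 <= tandem_drift (fun y => y.1%:R - c * y.2%:R) a b.
Proof.
move=> ml c; have c0 : 0 < c by rewrite divr_gt0// subr_gt0.
have mc : mu1 * c = lambda 0%N - mu1 by rewrite /c mulrCA divff ?mulr1// gt_eqF.
rewrite ler_pdivrMr// => lm a b; rewrite /tandem_drift /=.
have lb := lambda_ge0 b.
case: a => [|a]; case: b lb => [|b] lb /=; rewrite -?natr1.
- lra.
- have := mulr_gt0 mu2_gt0 c0; lra.
- lra.
- lra.
Qed.

End Tandem.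

Theorem proposition2 (R : realType) (lambda : nat -> R) (mu1 : R)
    (lambda_ge0 : forall n, 0 <= lambda n)
    (lambda0_gt0 : 0 < lambda 0%N)
    (lambda_nonincreasing : forall m n, (m <= n)%N -> lambda n <= lambda m)
    (lambda_eventually0 : exists N, forall n, (N <= n)%N -> lambda n = 0)
    (mu1_gt0 : 0 < mu1) :
  (lambda 0%N <= mu1 ->
     forall mu2 : R, 0 < mu2 ->
     forall (d : measure_display) (Omega : measurableType d)
       (X : minimal_process (tandem_rate lambda mu1 mu2) Omega), stable X)
  /\
  (mu1 < lambda 0%N ->
     exists2 M : R, 0 < M &
       forall mu2 : R, M < mu2 ->
       forall (d : measure_display) (Omega : measurableType d)
         (X : minimal_process (tandem_rate lambda mu1 mu2) Omega), ~ stable X).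
Proof.
split=> [l0 mu2 mu2_gt0 d Omega X|l0].
  have [N lN] := lambda_eventually0.
  have [f f0 [F [eps eps0 fF]]] := negative_drift lambda0_gt0 lambda_nonincreasing
    mu1_gt0 mu2_gt0 lN l0.
  split; first exact: tandem_irreducible.
  by move=> x; right; exact: (tandem_recurrent _ _ _ _ _ X x eps0 f0 fF).
pose c := (lambda 0%N - mu1) / mu1.
have c0 : 0 < c by rewrite divr_gt0// subr_gt0.
exists (lambda 0%N / c); first by rewrite divr_gt0.
move=> mu2 Mmu2 d Omega X [_ /(_ (0%N, 0%N))].
have mu2_gt0 : 0 < mu2 by apply: lt_trans Mmu2; rewrite divr_gt0.
case.
  apply/eqP; rewrite gt_eqF//; exact: tandem_exit_rate_gt0.
apply: (@tandem_not_recurrent _ _ _ _ _ _ _ _ _ _ _ X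
  (fun y => y.1%:R - c * y.2%:R) (1 + c)) => //=.
- by rewrite mulr0 subr0.
- by rewrite mulr0 subr0.
- by rewrite addr_gt0.
- by apply: positive_drift => //; exact: ltW.
- move=> [a b] z; rewrite !inE => /or3P[] /eqP-> /=.
  + by rewrite -natr1; lra.
  + rewrite -natr1; case: a => [|a] /=; rewrite -?natr1; lra.
  + case: b => [|b] /=; rewrite -?natr1; lra.
Qed.
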